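(* Let $S$ and $T$ be disjoint nonempty finite sets, $V=S\cup T$, and let $p_T$ be a positively intersecting supermodular set-function on $T$ with $p_T(\emptyset)=0$ and $p_T(Y)\le|S|$ for every $Y\subseteq T$. Define $b_0$ on subsets of $V$ by $$b_0(X\cup Z)=\min\{\,|T-Z|\,|X|-\widetilde p_T(\mathcal T)+|\mathcal T|\,|X|\ :\ \mathcal T\text{ a subpartition of }Z\,\}\qquad(X\subseteq S,\ Z\subseteq T).$$ Then $b_0$ is fully submodular, i.e. $b_0(U_1)+b_0(U_2)\ge b_0(U_1\cap U_2)+b_0(U_1\cup U_2)$ for all $U_1,U_2\subseteq V$.
   Context: A subpartition of $Z$ is a family of pairwise disjoint nonempty subsets of $Z$ (the empty family is allowed); $\widetilde p_T(\mathcal T)=\sum_{W\in\mathcal T}p_T(W)$, which is $0$ for the empty family. $p_T$ is positively intersecting supermodular if $p_T(X)+p_T(Y)\le p_T(X\cap Y)+p_T(X\cup Y)$ whenever $X\cap Y\ne\emptyset$, $p_T(X)>0$, $p_T(Y)>0$. *)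

(* Defs.v *)
From mathcomp Require Import all_boot all_order all_algebra.

Set Implicit Arguments.
Unset Strict Implicit.
Unset Printing Implicit Defensive.

Import Order.TTheory GRing.Theory Num.Theory.
Local Open Scope ring_scope.

Definition subpartition (V : finType) (Z : {set V}) (F : {set {set V}}) : bool :=
  [&& trivIset F, set0 \notin F & cover F \subset Z].

Definition ptilde (R : realDomainType) (V : finType) (p : {set V} -> R)
    (F : {set {set V}}) : R :=
  \sum_(W in F) p W.

(* A set-function on T is represented by a function on all subsets of the ground
   type V, of which only the values on subsets of T are constrained or used. *)
Definition pos_intersecting_supermodular (R : realDomainType) (V : finType)
    (T : {set V}) (p : {set V} -> R) : Prop :=
  forall X Y : {set V}, X \subset T -> Y \subset T ->
    X :&: Y != set0 -> 0 < p X -> 0 < p Y ->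
    p X + p Y <= p (X :&: Y) + p (X :|: Y).

Definition fully_submodular (R : realDomainType) (V : finType)
    (b : {set V} -> R) : Prop :=
  forall U1 U2 : {set V}, b (U1 :&: U2) + b (U1 :|: U2) <= b U1 + b U2.

Definition b0_val (R : realDomainType) (V : finType) (T : {set V})
    (p : {set V} -> R) (X Z : {set V}) (F : {set {set V}}) : R :=
  (#|T :\: Z| * #|X|)%:R - ptilde p F + (#|F| * #|X|)%:R.

(* When S and T partition V, every U is X :|: Z for the unique X = U :&: S and
   Z = U :&: T.  The seed set0 of the arg min is the empty family, which is a
   subpartition of every Z, so the minimum is over a nonempty set. *)
Definition b0 (R : realDomainType) (V : finType) (S T : {set V})
    (p : {set V} -> R) (U : {set V}) : R :=
  let X := U :&: S in
  let Z := U :&: T in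
  b0_val T p X Z
    [arg min_(F < set0 | subpartition Z F) b0_val T p X Z F]%O.

(* Main.v *)
(** Fix optimal subpartitions [F1], [F2] for [U1], [U2].  By optimality all their
    members may be taken positive, and no nonempty subset of a member has a larger
    value.  Uncross by growing a component [U], absorbing one member [N] meeting it
    at a time: [N :&: U] goes to the family [B] for the intersection, and
    [p (N :&: U) <= p N] gives [p (U :|: N) >= p U > 0], so [U] stays positive.
    A finished component goes to the family [A] for the union; a member that meets
    nothing goes to [B] if it lies inside the other ground set and to [A] otherwise.
    Hence [#|A| + #|B| <= #|F1| + #|F2|], [#|A| <= #|F1| + #|Z2 :\: Z1|] and
    [#|A| <= #|F2| + #|Z1 :\: Z2|], where [Zi] is the [T]-part of [Ui].  With
    [a = #|X1 :&: X2|], [d1 = #|X1 :\: X2|], [d2 = #|X2 :\: X1|] on the [S]-parts,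
    the defect of submodularity is at least the combination of these three
    inequalities with coefficients [a], [d1], [d2]. *)
Require Import Defs.
From mathcomp Require Import all_boot all_order all_algebra.
From mathcomp Require Import zify lra.

Set Implicit Arguments.
Unset Strict Implicit.
Unset Printing Implicit Defensive.

Import Order.TTheory GRing.Theory Num.Theory.
Local Open Scope ring_scope.

(** * Subpartitions: adding and removing a member *)

Lemma disjoint_setUr (V : finType) (A B C : {set V}) :
  [disjoint A & B :|: C] = [disjoint A & B] && [disjoint A & C].
Proof. by rewrite -!setI_eq0 setIUr setU_eq0. Qed.

(** Certifies that a set added to a family is new, so that the size and [ptilde] change by exactly
    one term. *)
Lemma disjoint_cover_notin (V : finType) (D : {set V}) (F : {set {set V}}) :
  D != set0 -> [disjoint D & cover F] -> D \notin F.
Proof.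
move=> /set0Pn[v vD] dis; apply/negP => DF.
have := disjointFr dis vD; suff -> : v \in cover F by [].
by apply/bigcupP; exists D.
Qed.

Lemma subpartition0 (V : finType) (Z : {set V}) : subpartition Z set0.
Proof.
rewrite /subpartition inE /cover big_set0 sub0set /= andbT.
by apply/trivIsetP => A B; rewrite inE.
Qed.

Lemma subpartitionU1 (V : finType) (Z D : {set V}) (F : {set {set V}}) :
  subpartition Z F -> D != set0 -> D \subset Z -> [disjoint D & cover F] ->
  subpartition Z (D |: F).
Proof.
move=> /and3P[tF nF cF] D0 DZ dis; apply/and3P; split.
- have disF : {in F, forall W : {set V}, [disjoint D & W]}.
    by move=> W WF; apply: disjointWr (bigcup_sup W WF) dis.
  by have [] := trivIsetU1 disF tF nF.
- by rewrite in_setU1 negb_or eq_sym D0.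
- by rewrite /cover bigcup_setU big_set1 subUset DZ.
Qed.

Lemma subpartition_sub (V : finType) (Z Z' : {set V}) (F : {set {set V}}) :
  Z \subset Z' -> subpartition Z F -> subpartition Z' F.
Proof. by move=> ZZ /and3P[tF nF cF]; rewrite /subpartition tF nF (subset_trans cF). Qed.

Lemma subpartition_subfamily (V : finType) (Z : {set V}) (F G : {set {set V}}) :
  G \subset F -> subpartition Z F -> subpartition Z G.
Proof.
move=> GF /and3P[tF nF cF]; apply/and3P; split.
- exact: trivIsetS tF.
- by apply: contra nF; apply: (subsetP GF).
- by apply: subset_trans cF; apply/bigcupsP => W /(subsetP GF); apply: bigcup_sup.
Qed.

Lemma coverD1 (V : finType) (F : {set {set V}}) (N : {set V}) :
  N \in F -> cover F = N :|: cover (F :\ N).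
Proof. by move=> NF; rewrite /cover (big_setD1 N). Qed.

Lemma subpartition_disjointD1 (V : finType) (Z N : {set V}) (F : {set {set V}}) :
  subpartition Z F -> N \in F -> [disjoint N & cover (F :\ N)].
Proof.
move=> /and3P[/trivIsetP tF _ _] NF; apply/bigcup_disjointP => W; rewrite !inE.
by move=> /andP[WN WF]; apply: tF; rewrite // eq_sym.
Qed.

(** * Tight families and the outcome of uncrossing *)

(** What optimality provides: a nonpositive member could be dropped, and a member could be exchanged
    for a better nonempty subset of it. *)
Definition tight (R : realDomainType) (V : finType) (p : {set V} -> R)
    (F : {set {set V}}) : Prop :=
  forall W, W \in F ->
    0 < p W /\ forall D : {set V}, D \subset W -> D != set0 -> p D <= p W.

Lemma tightD1 (R : realDomainType) (V : finType) (p : {set V} -> R)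
    (F : {set {set V}}) (N : {set V}) : tight p F -> tight p (F :\ N).
Proof. by move=> tF W /setD1P[_ /tF]. Qed.

Lemma ptildeU1 (R : realDomainType) (V : finType) (p : {set V} -> R)
    (F : {set {set V}}) (D : {set V}) :
  D \notin F -> ptilde p (D |: F) = p D + ptilde p F.
Proof. by move=> DF; rewrite /ptilde big_setU1. Qed.

Lemma ptildeD1 (R : realDomainType) (V : finType) (p : {set V} -> R)
    (F : {set {set V}}) (N : {set V}) :
  N \in F -> ptilde p F = p N + ptilde p (F :\ N).
Proof. by move=> NF; rewrite /ptilde (big_setD1 N). Qed.

(* [U] is the component being grown, [set0] if there is none. *)
Definition uncrossed (R : realDomainType) (V : finType) (p : {set V} -> R)
    (Z1 Z2 : {set V}) (F1 F2 : {set {set V}}) (U : {set V}) : Prop :=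
  exists A B : {set {set V}},
  [/\ subpartition (U :|: (cover F1 :|: cover F2)) A,
      subpartition (Z1 :&: Z2 :&: (cover F1 :|: cover F2)) B,
      p U + ptilde p F1 + ptilde p F2 <= ptilde p A + ptilde p B &
      [/\ (#|A| + #|B| <= (U != set0) + #|F1| + #|F2|)%N,
          (#|A| <= (U != set0) + #|F1| + #|cover F2 :\: Z1|)%N &
          (#|A| <= (U != set0) + #|F2| + #|cover F1 :\: Z2|)%N]].

(* [cardsD1] and [cardsU1] instantiate [T] to the canonical [finType] of
   [{set V}], which [lia] does not identify with the [reverse_coercion] that
   elaboration leaves in [#|F|]. *)
Lemma card_familyD1 (V : finType) (F : {set {set V}}) (N : {set V}) :
  N \in F -> #|F| = #|F :\ N|.+1.
Proof. by move=> NF; rewrite (cardsD1 N) NF. Qed.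

Lemma card_familyU1 (V : finType) (F : {set {set V}}) (D : {set V}) :
  D \notin F -> #|D |: F| = #|F|.+1.
Proof. by move=> DF; rewrite cardsU1 DF. Qed.

(** Lets the steps below treat a member of [F1] only. *)
Lemma uncrossedC (R : realDomainType) (V : finType) (p : {set V} -> R)
    (Z1 Z2 : {set V}) (F1 F2 : {set {set V}}) (U : {set V}) :
  uncrossed p Z1 Z2 F1 F2 U -> uncrossed p Z2 Z1 F2 F1 U.
Proof.
move=> [A [B [sA sB le [c1 c2 c3]]]]; exists A, B.
rewrite (setUC (cover F2)) (setIC Z2); split; [exact: sA | exact: sB | |].
  by rewrite addrAC.
by rewrite addnAC; split.
Qed.

(** * The uncrossing steps and their induction *)

Section Uncrossing.

Variables (R : realDomainType) (V : finType) (T : {set V}) (p : {set V} -> R).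
Hypothesis hp : pos_intersecting_supermodular T p.
Hypothesis hp0 : p set0 = 0.

Lemma supermodular_setU_gt0 (U N : {set V}) :
  U \subset T -> N \subset T -> U :&: N != set0 -> 0 < p U -> 0 < p N ->
  p (U :&: N) <= p N ->
  p U + p N <= p (U :&: N) + p (U :|: N) /\ 0 < p (U :|: N).
Proof.
by move=> UT NT D0 pU pN le; have := hp UT NT D0 pU pN; split; lra.
Qed.

(** The component is kept as [U1 :|: U2], with [Ui] inside [Zi] and apart from what is left of [Fi].
    So [N] can meet it only in [U2], and the overlap lies in both ground sets. [F1] loses a member
    and the family for the intersection gains one. *)
Lemma uncrossed_absorb (Z1 Z2 U1 U2 N : {set V}) (F1 F2 : {set {set V}}) :
  Z1 \subset T -> Z2 \subset T -> subpartition Z1 F1 -> tight p F1 ->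
  U1 \subset Z1 -> U2 \subset Z2 ->
  [disjoint U1 & cover F1] -> [disjoint U2 & cover F2] ->
  0 < p (U1 :|: U2) -> N \in F1 -> (U1 :|: U2) :&: N != set0 ->
  (0 < p (U1 :|: N :|: U2) ->
    uncrossed p Z1 Z2 (F1 :\ N) F2 (U1 :|: N :|: U2)) ->
  uncrossed p Z1 Z2 F1 F2 (U1 :|: U2).
Proof.
move=> Z1T Z2T sF1 tF1 U1Z U2Z d1 d2 pU NF D0 IH.
have U0 : U1 :|: U2 != set0 by apply: contraNneq D0 => ->; rewrite set0I.
have [pN mN] := tF1 _ NF.
have cF1 := coverD1 NF; have dN := subpartition_disjointD1 sF1 NF.
have NZ : N \subset Z1.
  by case/and3P: sF1 => _ _; apply: subset_trans; rewrite cF1 subsetUl.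
have [] := @supermodular_setU_gt0 (U1 :|: U2) N _ _ D0 pU pN (mN _ (subsetIr _ _) D0).
- by rewrite subUset (subset_trans U1Z) // (subset_trans U2Z).
- exact: subset_trans Z1T.
rewrite setUAC => le pos; have [A [B [sA sB leAB [c1 c2 c3]]]] := IH pos.
set D := _ :&: N in le D0.
have NU0 : U1 :|: N :|: U2 != set0.
  by apply: contraNneq U0 => /eqP; rewrite !setU_eq0 => /andP[/andP[-> _] ->].
have DU2 : D \subset U2.
  apply/subsetP => v; rewrite !inE => /andP[/orP[vU vN|//]].
  by have := disjointFr d1 vU; rewrite cF1 inE vN.
have DN : D \subset N := subsetIr _ _.
(* [B] lives on the remaining members; those of [F1] avoid [N] and those of [F2] avoid [U2]. *)
have dD : [disjoint D & cover B].
  have /and3P[_ _ cB] := sB; apply: disjointWr cB _; apply: disjointWr (subsetIr _ _) _.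
  by rewrite disjoint_setUr (disjointWl DN) // (disjointWl DU2).
exists A, (D |: B); have DB := disjoint_cover_notin D0 dD; split.
- apply: subpartition_sub sA; rewrite cF1; apply/subsetP => v; rewrite !inE.
  by do ![case: (v \in _) => //=].
- apply: subpartitionU1 => //.
    apply: subpartition_sub sB; rewrite cF1; apply/subsetP => v; rewrite !inE.
    by do ![case: (v \in _) => //=].
  by rewrite !subsetI (subset_trans DN NZ) (subset_trans DU2 U2Z) cF1 -setUA subsetU ?DN.
- by rewrite ptildeU1 // (ptildeD1 p NF); move: leAB le; clear; lra.
- have := card_familyD1 NF; rewrite card_familyU1 //.
  have : (#|cover (F1 :\ N) :\: Z2| <= #|cover F1 :\: Z2|)%N.
    by rewrite subset_leq_card // setSD // cF1 subsetUr.
  by move: c1 c2 c3; rewrite NU0 U0; clear; split; lia.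
Qed.

(** Opens a component: [N] and [Y] are traded for their intersection, put into [B], and their union.
    The new component takes the place of one lost member in each count. *)
Lemma uncrossed_join (Z1 Z2 N Y : {set V}) (F1 F2 : {set {set V}}) :
  Z1 \subset T -> Z2 \subset T -> subpartition Z1 F1 -> tight p F1 ->
  subpartition Z2 F2 -> tight p F2 ->
  N \in F1 -> Y \in F2 -> N :&: Y != set0 ->
  (0 < p (N :|: Y) -> uncrossed p Z1 Z2 (F1 :\ N) (F2 :\ Y) (N :|: Y)) ->
  uncrossed p Z1 Z2 F1 F2 set0.
Proof.
move=> Z1T Z2T sF1 tF1 sF2 tF2 NF YF D0 IH.
have [pN mN] := tF1 _ NF; have [pY mY] := tF2 _ YF.
have cF1 := coverD1 NF; have dN := subpartition_disjointD1 sF1 NF.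
have cF2 := coverD1 YF; have dY := subpartition_disjointD1 sF2 YF.
have NZ : N \subset Z1.
  by case/and3P: sF1 => _ _; apply: subset_trans; rewrite cF1 subsetUl.
have YZ : Y \subset Z2.
  by case/and3P: sF2 => _ _; apply: subset_trans; rewrite cF2 subsetUl.
have [||le pos] := @supermodular_setU_gt0 N Y _ _ D0 pN pY (mY _ (subsetIr _ _) D0).
- exact: subset_trans Z1T.
- exact: subset_trans Z2T.
have [A [B [sA sB leAB [c1 c2 c3]]]] := IH pos.
have U0 : N :|: Y != set0.
  by apply: contraNneq D0 => /eqP; rewrite setU_eq0 => /andP[/eqP-> _]; rewrite set0I.
have dD : [disjoint N :&: Y & cover B].
  have /and3P[_ _ cB] := sB; apply: disjointWr cB _; apply: disjointWr (subsetIr _ _) _.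
  by rewrite disjoint_setUr (disjointWl (subsetIl _ _) dN) (disjointWl (subsetIr _ _) dY).
exists A, (N :&: Y |: B); have DB := disjoint_cover_notin D0 dD; split.
- apply: subpartition_sub sA; rewrite cF1 cF2; apply/subsetP => v; rewrite !inE.
  by do ![case: (v \in _) => //=].
- apply: subpartitionU1 => //.
    apply: subpartition_sub sB; rewrite cF1 cF2; apply/subsetP => v; rewrite !inE.
    by do ![case: (v \in _) => //=].
  apply/subsetP => v; rewrite cF1 !inE => /andP[vN vY].
  by rewrite (subsetP NZ) // (subsetP YZ) // vN.
- by rewrite ptildeU1 // (ptildeD1 p NF) (ptildeD1 p YF) hp0; move: leAB le; clear; lra.
- have eF1 := card_familyD1 NF; have eF2 := card_familyD1 YF.
  rewrite card_familyU1 // eqxx; move: eF1 eF2.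
  have : (#|cover (F1 :\ N) :\: Z2| <= #|cover F1 :\: Z2|)%N.
    by rewrite subset_leq_card // setSD // cF1 subsetUr.
  have : (#|cover (F2 :\ Y) :\: Z1| <= #|cover F2 :\: Z1|)%N.
    by rewrite subset_leq_card // setSD // cF2 subsetUr.
  by move: c1 c2 c3; rewrite U0; clear; split; lia.
Qed.

Lemma uncrossed_isolated (Z1 Z2 N : {set V}) (F1 F2 : {set {set V}}) :
  subpartition Z1 F1 -> N \in F1 -> [disjoint N & cover F2] ->
  uncrossed p Z1 Z2 (F1 :\ N) F2 set0 -> uncrossed p Z1 Z2 F1 F2 set0.
Proof.
move=> sF1 NF dNF2 [A [B [sA sB leAB [c1 c2 c3]]]].
have cF1 := coverD1 NF; have dN := subpartition_disjointD1 sF1 NF.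
have NZ : N \subset Z1.
  by case/and3P: sF1 => _ _; apply: subset_trans; rewrite cF1 subsetUl.
have N0 : N != set0 by case/and3P: sF1 => _ + _; apply: contraNneq => <-.
have dNU : [disjoint N & cover (F1 :\ N) :|: cover F2].
  by rewrite disjoint_setUr dN.
have eF1 := card_familyD1 NF.
have le1 : (#|cover (F1 :\ N) :\: Z2| <= #|cover F1 :\: Z2|)%N.
  by rewrite subset_leq_card // setSD // cF1 subsetUr.
have sA' : subpartition (set0 :|: (cover F1 :|: cover F2)) A.
  by apply: subpartition_sub sA; rewrite cF1 !set0U -setUA subsetUr.
have sB' : subpartition (Z1 :&: Z2 :&: (cover F1 :|: cover F2)) B.
  by apply: subpartition_sub sB; rewrite setIS // cF1 -setUA subsetUr.
(* Inside [Z2], [N] may join [B], and the bounds on [A] are unaffected. *)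
have [NZ2|NZ2] := boolP (N \subset Z2).
  have dD : [disjoint N & cover B].
    by have /and3P[_ _ cB] := sB; apply: disjointWr cB _; apply: disjointWr (subsetIr _ _) _.
  have DB := disjoint_cover_notin N0 dD.
  exists A, (N |: B); split=> //.
  - apply: subpartitionU1 => //.
    by rewrite !subsetI NZ NZ2 cF1 -setUA subsetUl.
  - by rewrite ptildeU1 // (ptildeD1 p NF); move: leAB; clear; lra.
  - by move: c1 c2 c3 le1 eF1; rewrite card_familyU1 // eqxx; clear; split; lia.
have dD : [disjoint N & cover A].
  by have /and3P[_ _ cA] := sA; apply: disjointWr cA _; rewrite set0U.
have DB := disjoint_cover_notin N0 dD.
exists (N |: A), B; split=> //.
- by apply: subpartitionU1 => //; rewrite set0U cF1 -setUA subsetUl.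
- by rewrite ptildeU1 // (ptildeD1 p NF); move: leAB; clear; lra.
(* A point of [N] outside [Z2] pays for the extra member of [A] in the bound where [#|F2|] does not
   drop. *)
- have lt1 : (#|cover (F1 :\ N) :\: Z2| < #|cover F1 :\: Z2|)%N.
    apply: proper_card; apply/properP; split; first by rewrite setSD // cF1 subsetUr.
    have /subsetPn[v vN vZ] := NZ2; exists v.
      by rewrite !inE vZ cF1 inE vN.
    by rewrite !inE (disjointFr dN vN) andbF.
  by move: c1 c2 c3 lt1 eF1; rewrite card_familyU1 // eqxx; clear; split; lia.
Qed.

(** The remaining process never touches [U], so [U] becomes a member of [A], paid for by the summand
    [U != set0]. *)
Lemma uncrossed_detach (Z1 Z2 U : {set V}) (F1 F2 : {set {set V}}) :
  U != set0 -> [disjoint U & cover F1] -> [disjoint U & cover F2] ->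
  uncrossed p Z1 Z2 F1 F2 set0 -> uncrossed p Z1 Z2 F1 F2 U.
Proof.
move=> U0 d1 d2 [A [B [sA sB leAB [c1 c2 c3]]]].
have dD : [disjoint U & cover A].
  have /and3P[_ _ cA] := sA; apply: disjointWr cA _.
  by rewrite set0U disjoint_setUr d1.
have DB := disjoint_cover_notin U0 dD.
exists (U |: A), B; split=> //.
- apply: subpartitionU1; rewrite ?subsetUl //.
  by apply: subpartition_sub sA; rewrite set0U subsetUr.
- by rewrite ptildeU1 //; move: leAB; rewrite hp0; clear; lra.
- by move: c1 c2 c3; rewrite card_familyU1 // eqxx U0; clear; split; lia.
Qed.

(** Induction on the number of remaining members, plus one if a component is open; absorbing,
    joining, detaching and setting aside an isolated member each lower this measure. *)
Lemma uncrossing (Z1 Z2 U1 U2 : {set V}) (F1 F2 : {set {set V}}) :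
  Z1 \subset T -> Z2 \subset T ->
  subpartition Z1 F1 -> tight p F1 -> subpartition Z2 F2 -> tight p F2 ->
  U1 \subset Z1 -> U2 \subset Z2 ->
  [disjoint U1 & cover F1] -> [disjoint U2 & cover F2] ->
  (U1 :|: U2 != set0 -> 0 < p (U1 :|: U2)) ->
  uncrossed p Z1 Z2 F1 F2 (U1 :|: U2).
Proof.
have [n] := ubnP ((U1 :|: U2 != set0) + #|F1| + #|F2|)%N.
elim: n Z1 Z2 U1 U2 F1 F2 => // n IHn Z1 Z2 U1 U2 F1 F2.
rewrite ltnS => len Z1T Z2T sF1 tF1 sF2 tF2 U1Z U2Z d1 d2 pU.
have sD1 (F : {set {set V}}) (Z N : {set V}) : subpartition Z F -> subpartition Z (F :\ N).
  by apply: subpartition_subfamily; apply: subD1set.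
have subZ F Z (N : {set V}) : subpartition Z F -> N \in F -> N \subset Z.
  by move=> /and3P[_ _ cF] NF; apply: subset_trans cF; apply: bigcup_sup.
have dD1 F (N U : {set V}) : [disjoint U & cover F] -> [disjoint U & cover (F :\ N)].
  by apply: disjointWr; apply/bigcupsP => W /setD1P[_]; apply: bigcup_sup.
have IH0 (G1 G2 : {set {set V}}) : (#|G1| + #|G2| < n)%N -> subpartition Z1 G1 -> tight p G1 ->
    subpartition Z2 G2 -> tight p G2 -> uncrossed p Z1 Z2 G1 G2 set0.
  move=> lt *; rewrite -(setU0 set0); apply: IHn; rewrite ?sub0set ?disjoints0 //.
  - by rewrite setU0 eqxx.
  - by rewrite -setI_eq0 set0I.
  - by rewrite -setI_eq0 set0I.
  - by rewrite setU0 eqxx.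
have [U0|U0] := eqVneq (U1 :|: U2) set0; last first.
  have {}pU := pU U0; rewrite U0 in len.
  have meet F : ~~ [disjoint U1 :|: U2 & cover F] ->
      exists2 N, N \in F & (U1 :|: U2) :&: N != set0.
    case/pred0Pn=> v /= /andP[vU /bigcupP[N NF vN]]; exists N => //.
    by apply/set0Pn; exists v; rewrite inE vU.
  have [dis1|/meet[N NF D0]] := boolP [disjoint U1 :|: U2 & cover F1]; last first.
    have eF1 := card_familyD1 NF.
    have dN := subpartition_disjointD1 sF1 NF.
    apply: (uncrossed_absorb (N := N)) => // pUN; apply: IHn => //.
    - by move: len eF1; clear; case: (_ != _); lia.
    - exact: sD1.
    - exact: tightD1.
    - by rewrite subUset U1Z (subZ F1).
    - by rewrite disjoint_sym disjoint_setUr disjoint_sym dD1 // disjoint_sym.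
  have [dis2|/meet[N NF D0]] := boolP [disjoint U1 :|: U2 & cover F2]; last first.
    have eF2 := card_familyD1 NF.
    have dN := subpartition_disjointD1 sF2 NF.
    (* The same absorption with the two sides exchanged. *)
    rewrite setUC; apply: uncrossedC.
    apply: (uncrossed_absorb (N := N)); rewrite // ?(setUC U2 U1) // => pUN.
    apply: IHn => //.
    - by move: len eF2; clear; case: (_ != _); lia.
    - exact: sD1.
    - exact: tightD1.
    - by rewrite subUset U2Z (subZ F2).
    - by rewrite disjoint_sym disjoint_setUr disjoint_sym dD1 // disjoint_sym.
  by apply: uncrossed_detach => //; apply: IH0.
rewrite U0.
have [/existsP[N /existsP[Y /and3P[NF YF D0]]]|none] :=
    boolP [exists N, exists Y, [&& N \in F1, Y \in F2 & N :&: Y != set0]].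
  have eF1 := card_familyD1 NF.
  have eF2 := card_familyD1 YF.
  have dN := subpartition_disjointD1 sF1 NF.
  have dY := subpartition_disjointD1 sF2 YF.
  apply: (uncrossed_join (N := N) (Y := Y)) => // pNY; apply: IHn => //.
  - by move: len eF1 eF2; rewrite U0 eqxx; clear; case: (_ != _); lia.
  - exact: sD1.
  - exact: tightD1.
  - exact: sD1.
  - exact: tightD1.
  - exact: subZ sF1 NF.
  - exact: subZ sF2 YF.
(* No two members cross any more: [F1] is emptied first, then [F2], one isolated member at a
   time. *)
have dis N Y : N \in F1 -> Y \in F2 -> [disjoint N & Y].
  move=> NF YF; rewrite -setI_eq0; apply: contraNT none => D0.
  by apply/existsP; exists N; apply/existsP; exists Y; rewrite NF YF.
rewrite U0 eqxx in len.
have [F10|[N NF]] := set_0Vmem F1; last first.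
  have eF1 := card_familyD1 NF.
  apply: (uncrossed_isolated sF1 NF).
    by apply/bigcup_disjointP => Y YF; apply: dis.
  apply: IH0 => //; [by move: len eF1; clear; lia | exact: sD1 | exact: tightD1].
have [F20|[Y YF]] := set_0Vmem F2; last first.
  have eF2 := card_familyD1 YF.
  apply/uncrossedC/(uncrossed_isolated sF2 YF).
    by rewrite F10 /cover big_set0 -setI_eq0 setI0.
  by apply/uncrossedC/IH0 => //; [by move: len eF2; clear; lia | exact: sD1 | exact: tightD1].
exists set0, set0; rewrite F10 F20; split; try exact: subpartition0.
- by rewrite /ptilde !big_set0 hp0 !addr0.
- by rewrite eqxx !cards0.
Qed.

End Uncrossing.

(** * Optimal subpartitions and the final count *)

Lemma b0_le (R : realDomainType) (V : finType) (S T U : {set V})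
    (p : {set V} -> R) (F : {set {set V}}) :
  subpartition (U :&: T) F -> b0 S T p U <= b0_val T p (U :&: S) (U :&: T) F.
Proof.
have s0 := subpartition0 (U :&: T).
by rewrite /b0; case: arg_minP => // G sG; apply.
Qed.

Lemma optimal_subpartition (R : realDomainType) (V : finType) (S T U : {set V})
    (p : {set V} -> R) :
  exists F, [/\ subpartition (U :&: T) F, tight p F &
    b0 S T p U = b0_val T p (U :&: S) (U :&: T) F].
Proof.
have s0 := subpartition0 (U :&: T).
have [G sG bG] : exists2 G, subpartition (U :&: T) G &
    b0 S T p U = b0_val T p (U :&: S) (U :&: T) G.
  by rewrite /b0; case: arg_minP => // G sG _; exists G.
pose F := [set W in G | 0 < p W].
have FG : F \subset G by apply/subsetP => W; rewrite inE => /andP[].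
have sF := subpartition_subfamily FG sG.
have bF : b0 S T p U = b0_val T p (U :&: S) (U :&: T) F.
  (* Dropping nonpositive members of [G] lowers neither [ptilde] nor the quality of the size term,
     so [F] is still optimal. *)
  apply/eqP; rewrite eq_le b0_le //= bG /b0_val lerD ?lerD2l ?lerN2 //.
    rewrite /ptilde [leLHS](bigID (fun W => 0 < p W)) /=.
    rewrite [leRHS](eq_bigl (fun W => (W \in G) && (0 < p W))); last first.
      by move=> W; rewrite inE.
    by rewrite gerDl sumr_le0 // => W /andP[_]; rewrite -leNgt.
  by rewrite ler_nat leq_mul2r subset_leq_card ?orbT.
exists F; split=> // W WF; split; first by have := WF; rewrite inE => /andP[].
move=> D DW D0.
have dD : [disjoint D & cover (F :\ W)].
  exact: disjointWl DW (subpartition_disjointD1 sF WF).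
have DF := disjoint_cover_notin D0 dD.
(* Exchanging [W] for [D] keeps the size, so optimality compares just [p D] with [p W]. *)
have sFD : subpartition (U :&: T) (D |: F :\ W).
  apply: subpartitionU1 => //; first exact: subpartition_subfamily (subD1set _ _) sF.
  by apply: subset_trans DW _; case/and3P: sF => _ _; apply: subset_trans; apply: bigcup_sup.
have := b0_le S p sFD; rewrite bF /b0_val (card_familyD1 WF) card_familyU1 //.
by rewrite (ptildeD1 p WF) ptildeU1 // lerD2r lerD2l lerN2 lerD2r.
Qed.

(** With [t] points of [T] outside both sets and [e1], [e2] in the differences of the [T]-parts, the
    right side minus the left is [a * (f1 + f2 - A - B) + d1 * (f1 + e2 - A) + d2 * (f2 + e1 - A) +
    (pA + pB - p1 - p2)]. *)
Lemma b0_val_count (R : realDomainType) (a d1 d2 t e1 e2 f1 f2 A B : nat)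
    (p1 p2 pA pB : R) :
  (A + B <= f1 + f2)%N -> (A <= f1 + e2)%N -> (A <= f2 + e1)%N ->
  p1 + p2 <= pA + pB ->
  ((t + e1 + e2) * a)%:R - pB + (B * a)%:R +
    ((t * (a + d1 + d2))%:R - pA + (A * (a + d1 + d2))%:R) <=
  ((t + e2) * (a + d1))%:R - p1 + (f1 * (a + d1))%:R +
    (((t + e1) * (a + d2))%:R - p2 + (f2 * (a + d2))%:R).
Proof.
move=> le le1 le2 lep.
(* The products are formed beforehand; after expansion the goal is linear in the monomials. *)
have := leq_mul2l a (A + B) (f1 + f2); rewrite le orbT.
have := leq_mul2l d1 A (f1 + e2); rewrite le1 orbT.
have := leq_mul2l d2 A (f2 + e1); rewrite le2 orbT.
rewrite -!(ler_nat R) !(natrM, natrD); move: lep; clear; lra.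
Qed.

Theorem theorem15 (R : realDomainType) (V : finType) (S T : {set V})
    (p : {set V} -> R)
    (hST : [disjoint S & T]) (hS : S != set0) (hT : T != set0)
    (hV : S :|: T = [set: V])
    (hp : pos_intersecting_supermodular T p)
    (hp0 : p set0 = 0)
    (hpS : forall Y : {set V}, Y \subset T -> p Y <= #|S|%:R) :
  fully_submodular (b0 S T p).
Proof.
move=> U1 U2.
have [F1 [sF1 tF1 ->]] := optimal_subpartition S T U1 p.
have [F2 [sF2 tF2 ->]] := optimal_subpartition S T U2 p.
(* The process starts with no open component. *)
have [] := @uncrossing R V T p hp hp0 (U1 :&: T) (U2 :&: T) set0 set0 F1 F2;
  rewrite ?subsetIr ?sub0set ?disjoints0 ?setU0 ?eqxx //.
- by rewrite -setI_eq0 set0I.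
- by rewrite -setI_eq0 set0I.
move=> A [B [sA sB]]; rewrite hp0 add0r => leAB [c1 c2 c3].
have /and3P[_ _ cF1] := sF1; have /and3P[_ _ cF2] := sF2.
have {}sA : subpartition ((U1 :|: U2) :&: T) A.
  by apply: subpartition_sub sA; rewrite set0U setIUl setUSS.
have {}sB : subpartition ((U1 :&: U2) :&: T) B.
  by apply: subpartition_sub sB; rewrite -setIIl subsetIl.
apply: le_trans (lerD (b0_le S p sB) (b0_le S p sA)) _.
rewrite /b0_val.
pose a := #|U1 :&: U2 :&: S|; pose t := #|T :\: ((U1 :|: U2) :&: T)|.
pose d1 := #|(U1 :&: S) :\: U2|; pose d2 := #|(U2 :&: S) :\: U1|.
pose e1 := #|(U1 :&: T) :\: U2|; pose e2 := #|(U2 :&: T) :\: U1|.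
have x1E : #|U1 :&: S| = (a + d1)%N by rewrite -(cardsID U2 (U1 :&: S)) setIAC.
have x2E : #|U2 :&: S| = (a + d2)%N.
  by rewrite -(cardsID U1 (U2 :&: S)) setIAC (setIC U2).
have x12E : #|(U1 :|: U2) :&: S| = (a + d1 + d2)%N.
  have := cardsUI (U1 :&: S) (U2 :&: S); rewrite -setIUl setIACA setIid x1E x2E -/a.
  by clear; lia.
have t1E : #|T :\: (U1 :&: T)| = (t + e2)%N.
  rewrite -(cardsID U2 (T :\: (U1 :&: T))) addnC; congr (_ + _)%N; apply/eq_card => v;
    by rewrite !inE; do ![case: (v \in _) => //=].
have t2E : #|T :\: (U2 :&: T)| = (t + e1)%N.
  rewrite -(cardsID U1 (T :\: (U2 :&: T))) addnC; congr (_ + _)%N; apply/eq_card => v;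
    by rewrite !inE; do ![case: (v \in _) => //=].
have t12E : #|T :\: (U1 :&: U2 :&: T)| = (t + e1 + e2)%N.
  have := cardsUI (T :\: (U1 :&: T)) (T :\: (U2 :&: T)).
  rewrite -setDIr -setDUr -setIUl setIACA setIid t1E t2E -/t.
  by clear; lia.
(* [F2] covers only points of [U2 :&: T], so at most [e2] of them lie outside [U1]. *)
have /(leq_trans c2) {}c2 : (0 + #|F1| + #|cover F2 :\: (U1 :&: T)| <= #|F1| + e2)%N.
  rewrite leq_add2l subset_leq_card //; apply: subset_trans (setSD _ cF2) _.
  by apply/subsetP => v; rewrite !inE; do ![case: (v \in _) => //=].
have /(leq_trans c3) {}c3 : (0 + #|F2| + #|cover F1 :\: (U2 :&: T)| <= #|F2| + e1)%N.
  rewrite leq_add2l subset_leq_card //; apply: subset_trans (setSD _ cF1) _.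
  by apply/subsetP => v; rewrite !inE; do ![case: (v \in _) => //=].
by rewrite x1E x2E x12E t1E t2E t12E; apply: b0_val_count.
Qed.
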